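(* Let $K>0$ be a real number. Then $\mathrm{sc}(\{f\in\mathbb{R}^{\mathbb{R}}: |f|\le K\})=\omega$, where $|f|\le K$ means $|f(x)|\le K$ for every $x\in\mathbb{R}$.
   Context: $\mathbb{R}^{\mathbb{R}}$ is the set of all functions $f:\mathbb{R}\to\mathbb{R}$. A difference operator is a map $D:\mathbb{R}^{\mathbb{R}}\to\mathbb{R}^{\mathbb{R}}$ of the form $(Df)(x)=\sum_{i=1}^n a_i f(x+b_i)$ with $a_i,b_i\in\mathbb{R}$; $\mathcal{D}$ is the set of difference operators. A system of difference equations is a set $S\subset\mathcal{D}\times\mathbb{R}^{\mathbb{R}}$; a function $f:\mathbb{R}\to\mathbb{R}$ is a solution to $S$ if $Df=g$ for every $(D,g)\in S$. A subsystem of $S$ is a subset of $S$. For $\mathcal{F}\subset\mathbb{R}^{\mathbb{R}}$ the solvability cardinal $\mathrm{sc}(\mathcal{F})$ is the minimal cardinal $\kappa$ with the following property: for every system $S$ of difference equations, if every subsystem of $S$ of cardinality less than $\kappa$ has a solution in $\mathcal{F}$, then $S$ has a solution in $\mathcal{F}$. *)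

(* Defs.v *)
From mathcomp Require Import all_boot all_order all_algebra.
From mathcomp Require Import all_classical all_reals.

Set Implicit Arguments.
Unset Strict Implicit.
Unset Printing Implicit Defensive.

Import Order.TTheory GRing.Theory Num.Theory.

Local Open Scope classical_set_scope.
Local Open Scope card_scope.
Local Open Scope ring_scope.

(* Cardinals are represented by sets (over arbitrary types), compared up to
   equipotence with the relation [#<=]. *)
Definition card_lt (T U : Type) (A : set T) (B : set U) : Prop :=
  A #<= B /\ ~ (B #<= A).

Definition difference_operator (R : realType) : set ((R -> R) -> (R -> R)) :=
  [set D | exists (n : nat) (a b : 'I_n -> R),
     forall (f : R -> R) (x : R), D f x = \sum_(i < n) a i * f (x + b i)].

(* An equation [D f = g] is the pair [(D, g)]. *)
Definition difference_equation (R : realType) : Type :=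
  (((R -> R) -> (R -> R)) * (R -> R))%type.

Definition difference_system (R : realType) (S : set (difference_equation R))
    : Prop :=
  S `<=` @difference_operator R `*` [set: R -> R].

Definition solution (R : realType) (S : set (difference_equation R))
    (f : R -> R) : Prop :=
  forall D g, S (D, g) -> D f = g.

Definition solvable_in (R : realType) (F : set (R -> R))
    (S : set (difference_equation R)) : Prop :=
  exists2 f, F f & solution S f.

Definition sc_property (R : realType) (F : set (R -> R))
    (V : Type) (k : set V) : Prop :=
  forall S : set (difference_equation R), difference_system S ->
    (forall S' : set (difference_equation R),
       S' `<=` S -> card_lt S' k -> solvable_in F S') ->
    solvable_in F S.

(* [sc(F)] is the cardinality of [k]. *)
Definition is_sc (R : realType) (F : set (R -> R))
    (V : Type) (k : set V) : Prop :=
  sc_property F k /\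
  forall (W : Type) (l : set W), card_lt l k -> ~ sc_property F l.

(* Main.v *)
From HB Require Import structures.
Require Import Defs.
From mathcomp Require Import all_boot all_order all_algebra.
From mathcomp Require Import all_classical all_reals.
From mathcomp Require Import finmap topology normedtype.
From mathcomp Require Import ring lra.

(** That [omega] suffices is compactness.  By Tychonoff's theorem the functions
    bounded by [K] form a compact subset of the product space [R -> R], and for
    a difference operator [D] the value [D f x] is a finite linear combination
    of coordinates of [f], so every equation [D f = g] cuts out a closed set.
    If each finite subsystem has a solution bounded by [K], these closed sets
    have the finite intersection property inside the compact box, and a common
    point solves the whole system ([sc_property_box]).

    That no finite cardinal suffices is shown by a system whose solutions are
    pinned by [n.+1] independent constraints.  Let [A_k] be the average of the
    translations by the subset sums of [{1, 1/2, ..., 2^-(k-1)}], and let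
    [D_k := A_k - A_(k+1)].  The square wave [w_l] of half-period [2^-l]
    satisfies [D_k w_l = w_l] if [k = l], [D_k w_l = 0] otherwise, and
    [A_m w_l = 0] for [l < m].  Consider the equations [D_k f = c w_k] for
    [k <= n], together with [A_(n+1) f = 0].  Since [f] telescopes as
    [A_(n+1) f + \sum_(k <= n) D_k f], the only solution is
    [c \sum_(k <= n) w_k], whose value at [0] is [(n + 1) c]
    ([wave_system_value0]).  A subsystem that misses the equation for [w_j] is
    solved by the sum without its [j]-th term, which is bounded by [n c]
    ([wave_system_drop]).  Taking [n c <= K < (n + 1) c] makes the system
    unsolvable in the box although all subsystems with at most [n] equations
    are solvable in it ([box_not_sc_property]). *)

Set Implicit Arguments.
Unset Strict Implicit.
Unset Printing Implicit Defensive.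

Import Order.TTheory GRing.Theory Num.Theory.
Import numFieldNormedType.Exports.

Local Open Scope classical_set_scope.
Local Open Scope card_scope.
Local Open Scope ring_scope.

(** * Compactness: finite subsystems suffice *)

Section Compactness.
Variable R : realType.
Implicit Types (D : (R -> R) -> R -> R) (f g : R -> R).

Lemma continuous_difference_operator D (x : R) : difference_operator D ->
  continuous (fun f : prod_topology (fun _ : R => R) => D f x).
Proof.
move=> [n [a [b DE]]] f.
rewrite (_ : (fun f => D f x) = (fun f => \sum_(i < n) a i * f (x + b i)));
  last by apply/funext => h; rewrite DE.
apply: continuous_big => [|i _ h]; first exact: add_continuous.
pose ev (h : prod_topology (fun _ : R => R)) : R := h (x + b i).
have ev_h : ev h' @[h' --> h] --> ev h.
  exact: (@proj_continuous R (fun=> R) (x + b i)).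
apply: (@cvgM R _ (nbhs h) _ (fun=> a i) ev (a i)) ev_h; exact: cvg_cst.
Qed.

Lemma closed_solutions D g : difference_operator D ->
  closed ([set f | D f = g] : set (prod_topology (fun _ : R => R))).
Proof.
move=> Dop.
rewrite (_ : [set f | D f = g] = \bigcap_x ((fun f => D f x) @^-1` [set g x])).
  apply: closed_bigI => x _; apply: closed_comp; last exact: closed_eq.
  by move=> f _; exact: continuous_difference_operator.
apply/seteqP; split=> f /= Df; first by move=> x _ /=; rewrite Df.
by apply/funext => x; apply: Df.
Qed.

Lemma compact_box (K : R) :
  compact ([set f | forall x, `|f x| <= K] :
    set (prod_topology (fun _ : R => R))).
Proof.
rewrite (_ : mkset _ = [set f : R -> R | forall x, [set` `[- K, K]] (f x)]).
  by apply: (@tychonoff R (fun=> R) (fun=> [set` `[- K, K]])) => _; exact: segment_compact.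
by apply/seteqP; split=> f /= fK x; have := fK x; rewrite /= in_itv/= ler_norml.
Qed.

Lemma sc_property_box (K : R) :
  sc_property [set f : R -> R | forall x : R, `|f x| <= K] [set: nat].
Proof.
set F := [set f : R -> R | _] => S Sdiff Sfin.
(* the finite intersection form of compactness asks for a pointed space; the
   base point is arbitrary *)
pose T : ptopologicalType :=
  HB.pack (prod_topology (fun _ : R => R)) (isPointed.Build _ (fun _ : R => 0)).
have : @compact T F by exact: compact_box.
rewrite compact_In0 => boxP.
pose I : choiceType := {classic difference_equation R}.
have [||f] := boxP I S (fun e : I => F `&` [set f | e.1 f = e.2]).
- exists (fun e : I => [set f | e.1 f = e.2]) => // e /Sdiff[Dop _].
  exact: closed_solutions.
- move=> E ES.
  have [||f Ff fsol] := Sfin [set` E].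
  + by move=> e /= eE; exact/set_mem/ES.
  + split; last by apply/finite_setPn; exact: (finite_fset E).
    by apply: finite_set_countable; exact: (finite_fset E).
  + by exists f => -[D g] eE; split => //; exact: fsol.
- (* the closed sets lie in the box, but if [S] is empty then none of them
     forces [f] into it *)
  move=> fS; have [->|/set0P[e Se]] := eqVneq S set0.
    have [||h Fh _] := Sfin set0 => //; last by exists h.
    by split => //; move=> /card_le0P; apply/eqP/set0P; exists 0%N.
  exists f; first by case: (fS e Se).
  by move=> D g Sg; have [_] := fS _ Sg.
Qed.

End Compactness.

(** * Unsolvable systems built from square waves *)

Section Averages.
Variable R : realType.
Implicit Types (f : R -> R) (k l m n : nat) (x : R).

Lemma difference_operator_id : difference_operator (fun f : R -> R => f).
Proof.
exists 1%N, (fun=> 1), (fun=> 0) => f x.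
by rewrite big_ord1 mul1r addr0.
Qed.

Lemma difference_operator_shift (D : (R -> R) -> R -> R) (u v s : R) :
  difference_operator D ->
  difference_operator (fun f x => u * D f x + v * D f (x + s)).
Proof.
move=> [n [a [b DE]]].
exists (n + n)%N,
  (fun i => match fintype.split i with inl j => u * a j | inr j => v * a j end),
  (fun i => match fintype.split i with inl j => b j | inr j => s + b j end) => f x.
rewrite !DE !mulr_sumr big_split_ord/=; congr (_ + _); apply: eq_bigr => i _.
- by rewrite -[lshift _ _]/(unsplit (inl i)) unsplitK mulrA.
- by rewrite -[rshift _ _]/(unsplit (inr i)) unsplitK mulrA addrA.
Qed.

(** The operator [A_k] with [A_0 = id], [A_(k+1) = A_k (1 + T) / 2], where [T]
    is the translation by [2^-k].  In Haar-wavelet terms it removes the waves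
    of half-period [1, ..., 2^-(k-1)], and [dyadic_detail k] isolates the
    half-period [2^-k]. *)
Fixpoint dyadic_avg k f x : R :=
  if k is k'.+1 then
    (dyadic_avg k' f x + dyadic_avg k' f (x + 2 ^- k')) / 2
  else f x.

Definition dyadic_detail k f x : R :=
  (dyadic_avg k f x - dyadic_avg k f (x + 2 ^- k)) / 2.

Lemma difference_operator_avg k : difference_operator (dyadic_avg k).
Proof.
elim: k => [|k IH]; first exact: difference_operator_id.
rewrite (_ : dyadic_avg k.+1 = fun f x =>
  2^-1 * dyadic_avg k f x + 2^-1 * dyadic_avg k f (x + 2 ^- k)).
  exact: difference_operator_shift.
by apply/funext => f; apply/funext => x /=; rewrite mulrDl ![_ / 2]mulrC.
Qed.

Lemma difference_operator_detail k : difference_operator (dyadic_detail k).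
Proof.
rewrite (_ : dyadic_detail k = fun f x =>
  2^-1 * dyadic_avg k f x + (- 2^-1) * dyadic_avg k f (x + 2 ^- k)).
  exact/difference_operator_shift/difference_operator_avg.
by apply/funext => f; apply/funext => x; rewrite /dyadic_detail; ring.
Qed.

(** [dyadic_detail k] is the difference of [dyadic_avg k] and
    [dyadic_avg k.+1], and [dyadic_avg 0] is the identity. *)
Lemma avg_telescope m f x :
  f x = dyadic_avg m f x + \sum_(k < m) dyadic_detail k f x.
Proof.
elim: m => [|m IH]; first by rewrite big_ord0 addr0.
by rewrite big_ord_recr/= {1}IH /dyadic_detail; field.
Qed.

Lemma dyadic_avg_sum k m (b : 'I_m -> R) (F : 'I_m -> R -> R) x :
  dyadic_avg k (fun y => \sum_(i < m) b i * F i y) x =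
  \sum_(i < m) b i * dyadic_avg k (F i) x.
Proof.
elim: k x => [//|k IH] x /=; rewrite !IH -big_split mulr_suml/=.
by apply: eq_bigr => i _; ring.
Qed.

Lemma dyadic_detail_sum k m (b : 'I_m -> R) (F : 'I_m -> R -> R) x :
  dyadic_detail k (fun y => \sum_(i < m) b i * F i y) x =
  \sum_(i < m) b i * dyadic_detail k (F i) x.
Proof.
rewrite /dyadic_detail !dyadic_avg_sum -sumrB mulr_suml.
by apply: eq_bigr => i _; ring.
Qed.

Definition square_wave l x : R := (-1) ^ Num.floor (2 ^+ l * x).

Lemma square_wave0 l : square_wave l 0 = 1.
Proof. by rewrite /square_wave mulr0 floor0. Qed.

Lemma norm_square_wave l x : `|square_wave l x| = 1.
Proof.
rewrite /square_wave; case: (Num.floor _) => n;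
  by rewrite /exprz ?normfV normrX normrN1 expr1n ?invr1.
Qed.

(** The shift by [2^-k] adds the integer [2^(l-k)] to the argument of the floor,
    and this integer is odd only for [k = l]. *)
Lemma square_wave_shift k l x : (k <= l)%N ->
  square_wave l (x + 2 ^- k) = (if k == l then -1 else 1) * square_wave l x.
Proof.
move=> kl; rewrite /square_wave.
have -> : 2 ^+ l * (x + 2 ^- k) = 2 ^+ l * x + (2 ^ (l - k))%N%:R :> R.
  rewrite mulrDr; congr (_ + _).
  by rewrite -{1}(subnK kl) exprD natrX mulfK// expf_neq0// pnatr_eq0.
rewrite floorDrz ?natr_int// (intrKfloor (2 ^ (l - k))%N).
rewrite expfzDr ?oppr_eq0 ?oner_eq0// mulrC; congr (_ * _).
rewrite -exprnP -signr_odd oddX subn_eq0 orbF.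
by rewrite eqn_leq kl /=; case: (l <= k)%N.
Qed.

(** A wave is periodic under the shifts by [2^-k] for [k < l], so averaging over
    them does not change it. *)
Lemma avg_wave_ge k l : (k <= l)%N ->
  dyadic_avg k (square_wave l) = square_wave l.
Proof.
elim: k => [//|k IH] kl; apply/funext => x /=.
by rewrite !(IH (ltnW kl)) (square_wave_shift _ (ltnW kl)) (ltn_eqF kl); field.
Qed.

(** Averaging a wave with its shift by half a period cancels it; the first
    [l] averaging steps leave [square_wave l] unchanged by [avg_wave_ge]. *)
Lemma avg_wave_lt k l : (l < k)%N -> dyadic_avg k (square_wave l) = (fun=> 0).
Proof.
elim: k => [//|k IH]; rewrite ltnS leq_eqVlt => /predU1P[->|lk];
  apply/funext => x /=; last by rewrite !IH// addr0 mul0r.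
by rewrite avg_wave_ge// square_wave_shift// eqxx; ring.
Qed.

Lemma detail_wave k l x :
  dyadic_detail k (square_wave l) x = (k == l)%:R * square_wave l x.
Proof.
rewrite /dyadic_detail; have [kl|lk] := leqP k l; last first.
  by rewrite avg_wave_lt// gtn_eqF// subrr !mul0r.
by rewrite avg_wave_ge// square_wave_shift//; case: eqP => _ /=; field.
Qed.

Lemma square_wave_inj : injective square_wave.
Proof.
suff H k l : (k < l)%N -> square_wave k <> square_wave l.
  by move=> k l kl; case: (ltngtP k l) => // /H; [|move=> /nesym].
move=> kl /(congr1 (fun h => dyadic_detail k h 0)).
rewrite !detail_wave eqxx (ltn_eqF kl) !square_wave0 mulr1 mul0r.
exact/eqP/oner_neq0.
Qed.

(** The equation for [dyadic_avg n] holds for every combination of the waves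
    involved; it removes the freedom left by the details, such as adding a
    constant. *)
Definition wave_system n (c : R) : set (difference_equation R) :=
  [set e | (exists2 k, (k < n)%N &
              e = (dyadic_detail k, fun x => c * square_wave k x))
           \/ e = (dyadic_avg n, fun=> 0)].

Lemma difference_system_wave n c : difference_system (wave_system n c).
Proof.
move=> e [[k _ ->]|->]; split => //=.
  exact: difference_operator_detail.
exact: difference_operator_avg.
Qed.

(** By [avg_telescope], [f] is the sum of its prescribed details, and all the
    waves equal [1] at [0], where their sum is therefore as large as possible. *)
Lemma wave_system_value0 n c f :
  solution (wave_system n c) f -> f 0 = n%:R * c.
Proof.
move=> fsol; rewrite (avg_telescope n f 0).
rewrite (fsol (dyadic_avg n) (fun=> 0)); last by right.
rewrite add0r (eq_bigr (fun=> c)).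
  by rewrite sumr_const card_ord mulr_natl.
move=> k _; rewrite (fsol _ (fun x => c * square_wave k x)); last first.
  by left; exists k.
by rewrite square_wave0 mulr1.
Qed.

(** The [n] waves other than the [j]-th, each of norm [c], already satisfy all
    the equations but the [j]-th one. *)
Lemma wave_system_drop n c j (S : set (difference_equation R)) :
  0 <= c -> (j <= n)%N -> S `<=` wave_system n.+1 c ->
  ~ S (dyadic_detail j, fun x => c * square_wave j x) ->
  solvable_in [set f | forall x, `|f x| <= n%:R * c] S.
Proof.
move=> c0 jn SW Sj.
pose b (l : 'I_n.+1) : R := if l == j :> nat then 0 else c.
exists (fun x => \sum_(l < n.+1) b l * square_wave l x) => [x /=|D g Sg].
  apply: (le_trans (ler_norm_sum _ _ _)).
  rewrite (eq_bigr b) => [|l _]; last first.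
    by rewrite normrM norm_square_wave mulr1 /b; case: ifP; rewrite ger0_norm.
  rewrite (bigD1 (Ordinal (jn : (j < n.+1)%N)))//= {1}/b eqxx add0r.
  rewrite (eq_bigr (fun=> c)) => [|l lj].
    by rewrite sumr_const cardC1 card_ord mulr_natl.
  by rewrite /b ifN.
have [[k kn]|] := SW _ Sg => /pair_equal_spec[DE gE]; rewrite {}DE {}gE in Sg *;
  apply/funext => x.
  rewrite dyadic_detail_sum (bigD1 (Ordinal kn))//= detail_wave eqxx mul1r.
  rewrite big1 ?addr0 => [|l lk].
    by rewrite /b/=; case: eqP => // kj; case: Sj; rewrite -kj.
  by rewrite detail_wave eq_sym (negPf (lk : l != k :> nat)) mul0r mulr0.
by rewrite dyadic_avg_sum big1// => l _; rewrite avg_wave_lt// mulr0.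
Qed.

Lemma wave_system_card n c (S : set (difference_equation R)) : c != 0 ->
  (forall k, (k < n)%N -> S (dyadic_detail k, fun x => c * square_wave k x)) ->
  `I_n #<= S.
Proof.
move=> c0 nS.
pose e k : difference_equation R :=
  (dyadic_detail k, fun x => c * square_wave k x).
have e_inj : {in `I_n &, injective e}.
  move=> k l _ _ [_ /funeqP kl]; apply: square_wave_inj.
  by apply/funext => x; exact: (mulfI c0 (kl x)).
have /card_eqPle[_ le_n] := inj_card_eq e_inj.
apply: card_le_trans le_n _; apply: subset_card_le => _ [k kn <-].
exact: nS.
Qed.

(** A subsystem of cardinality less than that of [l], hence less than [n.+1],
    cannot contain all the [n.+1] detail equations, so it falls under
    [wave_system_drop]. *)
Lemma box_not_sc_property (K : R) n (W : Type) (l : set W) : 0 < K ->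
  l #<= `I_n.+1 ->
  ~ sc_property [set f : R -> R | forall x : R, `|f x| <= K] l.
Proof.
(* [n + 1/2] lies between [n] and [n + 1], so [n c <= K < (n + 1) c] *)
move=> K0 ln sc; pose c : R := K / (n%:R + 2^-1).
have n0 : 0 < n%:R + 2^-1 :> R by rewrite ltr_wpDl// invr_gt0.
have c0 : 0 < c by rewrite divr_gt0.
have cK : (n%:R + 2^-1) * c = K by rewrite mulrC divfK// gt_eqF.
have [|f fK] := sc _ (@difference_system_wave n.+1 c).
  move=> S SW [_ lS].
  have [j jn Sj] : exists2 j, (j < n.+1)%N &
      ~ S (dyadic_detail j, fun x => c * square_wave j x).
    apply: contrapT => noj; apply: lS; apply: (card_le_trans ln).
    apply: (wave_system_card (lt0r_neq0 c0)) => k kn.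
    by apply: contrapT => Sk; apply: noj; exists k.
  have [f fc fsol] := wave_system_drop (n := n) (ltW c0) jn SW Sj.
  exists f => // x; apply: le_trans (fc x) _; nra.
move=> /wave_system_value0 f0; have := fK 0.
rewrite f0 => /(le_trans (ler_norm _)); rewrite -natr1; nra.
Qed.

End Averages.

Theorem theorem3p2 (R : realType) (K : R) (hK : 0 < K) :
  is_sc [set f : R -> R | forall x : R, `|f x| <= K] [set: nat].
Proof.
split; first exact: sc_property_box.
move=> W l [_ /finite_setPn /finite_set_leP[n ln]].
apply: (@box_not_sc_property _ _ n) => //; apply: card_le_trans ln _.
by rewrite card_le_II.
Qed.
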